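(* Let $N\in\mathbb N$. The $10$ spheres $S^{N-1}_{\mathbb R},S^{N-1}_{\mathbb R,*},S^{N-1}_{\mathbb R,+},\bar S^{N-1}_{\mathbb R,*},\bar S^{N-1}_{\mathbb R},S^{N-1}_{\mathbb C},S^{N-1}_{\mathbb C,**},S^{N-1}_{\mathbb C,+},\bar S^{N-1}_{\mathbb C,**},\bar S^{N-1}_{\mathbb C}$ can be written respectively as $$S^{N-1}_{\mathbb R,S_\infty},\ S^{N-1}_{\mathbb R,S_\infty^*},\ S^{N-1}_{\mathbb R,\{1\}},\ \bar S^{N-1}_{\mathbb R,S_\infty^*},\ \bar S^{N-1}_{\mathbb R,S_\infty},\ S^{N-1}_{\mathbb C,S_\infty},\ S^{N-1}_{\mathbb C,S_\infty^*},\ S^{N-1}_{\mathbb C,\{1\}},\ \bar S^{N-1}_{\mathbb C,S_\infty^*},\ \bar S^{N-1}_{\mathbb C,S_\infty},$$ and they are precisely the monomial spheres (over $\mathbb R,\mathbb C,\bar{\mathbb R},\bar{\mathbb C}$) having depth $k\le 3$.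
   Context: Noncommutative compact spaces are unital $C^*$-algebras with arrows reversed; $C(X)$ is the algebra of $X$. Spheres. $C(S^{N-1}_{\mathbb R,+})$ is the universal $C^*$-algebra generated by $z_1,\ldots,z_N$ with $z_i=z_i^*$, $\sum_i z_i^2=1$; $C(S^{N-1}_{\mathbb C,+})$ the one with $\sum_i z_iz_i^*=\sum_i z_i^*z_i=1$. The other spheres are given by quotients of $C(S^{N-1}_{\mathbb R,+})$ (real case) or $C(S^{N-1}_{\mathbb C,+})$ (complex case), by the following relations, where $a,b,c\in\{z_i\}$, $\alpha\in\{a,a^*\},\beta\in\{b,b^*\},\gamma\in\{c,c^*\}$: - $S^{N-1}_{\mathbb R},S^{N-1}_{\mathbb C}$: $\alpha\beta=\beta\alpha$. - $\bar S^{N-1}_{\mathbb R},\bar S^{N-1}_{\mathbb C}$: $\alpha\beta=-\beta\alpha$ for $a,b$ distinct, $\alpha\beta=\beta\alpha$ otherwise. - $S^{N-1}_{\mathbb R,*},S^{N-1}_{\mathbb C,**}$: $\alpha\beta\gamma=\gamma\beta\alpha$. - $\bar S^{N-1}_{\mathbb R,*},\bar S^{N-1}_{\mathbb C,**}$: $\alpha\beta\gamma=-\gamma\beta\alpha$ for $a,b,c$ distinct, $\alpha\beta\gamma=\gamma\beta\alpha$ otherwise. Monomial spheres. Let $\dot{\mathbb K}\in\{\mathbb R,\mathbb C,\bar{\mathbb R},\bar{\mathbb C}\}$, with underlying field $\mathbb K\in\{\mathbb R,\mathbb C\}$, and let $\dot S^{N-1}_{\mathbb K}$ be respectively $S^{N-1}_{\mathbb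 R},S^{N-1}_{\mathbb C},\bar S^{N-1}_{\mathbb R},\bar S^{N-1}_{\mathbb C}$. A monomial relation over $\dot{\mathbb K}$ is a formula $a_{i_1}\ldots a_{i_k}=\pm a_{i_{\sigma(1)}}\ldots a_{i_{\sigma(k)}}$ with $\sigma\in S_k$, the sign (depending on $i_1,\ldots,i_k$) being the one making $z_{i_1}\ldots z_{i_k}=\pm z_{i_{\sigma(1)}}\ldots z_{i_{\sigma(k)}}$ hold over $\dot S^{N-1}_{\mathbb K}$ (so always $+$ in the untwisted case, and $(-1)^m$ in the twisted case, with $m$ the number of pairs $p<q$ such that $\sigma(p)>\sigma(q)$ and $i_{\sigma(p)}\neq i_{\sigma(q)}$). A monomial sphere over $\dot{\mathbb K}$ is a quantum subspace $S\subset S^{N-1}_{\mathbb K,+}$ with $C(S)=C(S^{N-1}_{\mathbb K,+})/\langle R\rangle$, where $R$ comes from a set of monomial relations, each applied for all indices $i_1,\ldots,i_k$ and to all the variables $a_i=z_i$ if $\mathbb K=\mathbb R$, and all choices $a_i\in\{z_i,z_i^*\}$ (made independently at each position of the word) if $\mathbb K=\mathbb C$. Let $S_\infty=\bigcup_k S_k$. For $E\subset S_\infty$, $\dot S^{N-1}_{\mathbb K,E}$ is the monomial sphere over $\dot{\mathbb K}$ whose relations come from the elements $\sigma\in E$; it is denoted $S^{N-1}_{\mathbb K,E}$ in the untwisted case and $\bar S^{N-1}_{\mathbb K,E}$ in the twisted case. $S_\infty^*=(S_n^* )_{n\ge1}$ is the group of permutations $\sigma\in S_\infty$ preserving the parity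 of positions (equivalently: when labelling cyclically the legs of the permutation diagram $\bullet\circ\bullet\circ\ldots$, each string joins a black leg to a white leg). The depth of a monomial sphere is the smallest $k\in\mathbb N\cup\{\infty\}$ such that the sphere can be written as $\dot S^{N-1}_{\mathbb K,E}$ with $E\subset S_k$. *)

(* Defs.v *)
From HB Require Import structures.
From mathcomp Require Import all_boot all_order all_algebra all_fingroup.
From mathcomp Require Import all_classical all_reals all_analysis.
From mathcomp Require Import complex.

Set Implicit Arguments.
Unset Strict Implicit.
Unset Printing Implicit Defensive.

Import Order.TTheory GRing.Theory Num.Theory numFieldNormedType.Exports.
Local Open Scope classical_set_scope.
Local Open Scope complex_scope.
Local Open Scope ring_scope.

(* Unital C*-algebras.  The product is part of this mixin because
   Hierarchy Builder rejects a new join of [PzRing] and [NormedModule], these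
   two being already below [NumDomain]; the instance after the structure gives
   the [pzRingType] operations and theory back.  The zero
   algebra is allowed (it is C(S^{N-1}) for N = 0), hence not [algType]. *)
HB.mixin Record isCStarAlgebra (R : realType) A
    of CompleteNormedModule R[i] A := {
  cstar_one : A;
  cstar_mul : A -> A -> A;
  star : A -> A;
  cstar_mulA : associative cstar_mul;
  cstar_mul1l : left_id cstar_one cstar_mul;
  cstar_mul1r : right_id cstar_one cstar_mul;
  cstar_mulDl : left_distributive cstar_mul +%R;
  cstar_mulDr : right_distributive cstar_mul +%R;
  cstar_scalerAl : forall (c : R[i]) (x y : A),
    c *: cstar_mul x y = cstar_mul (c *: x) y;
  cstar_scalerAr : forall (c : R[i]) (x y : A),
    c *: cstar_mul x y = cstar_mul x (c *: y);
  cstar_normM : forall x y : A, `|cstar_mul x y| <= `|x| * `|y|;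
  starK : forall x : A, star (star x) = x;
  starD : forall x y : A, star (x + y) = star x + star y;
  starZ : forall (c : R[i]) (x : A), star (c *: x) = Num.conj c *: star x;
  starM : forall x y : A, star (cstar_mul x y) = cstar_mul (star y) (star x);
  cstar_norm : forall x : A, `|cstar_mul (star x) x| = `|x| ^+ 2
}.

#[short(type="cstarType")]
HB.structure Definition CStarAlgebra (R : realType) :=
  { A of CompleteNormedModule R[i] A & isCStarAlgebra R A }.

#[non_forgetful_inheritance]
HB.instance Definition _ (R : realType) (A : cstarType R) :=
  GRing.Zmodule_isPzRing.Build (CStarAlgebra.sort A)
    cstar_mulA cstar_mul1l cstar_mul1r cstar_mulDl cstar_mulDr.

Section CStarTheory.
Variable R : realType.
Implicit Types A B : cstarType R.

Definition star_morphism A B (f : A -> B) : Prop :=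
  [/\ forall x y, f (x + y) = f x + f y,
      forall (c : R[i]) x, f (c *: x) = c *: f x,
      forall x y, f (x * y) = f x * f y,
      f 1 = 1 &
      forall x, f (star x) = star (f x)].

Definition is_universal N (P : forall B, ('I_N -> B) -> Prop)
    A (z : 'I_N -> A) : Prop :=
  P A z /\
  forall B (w : 'I_N -> B), P B w ->
    exists! f : A -> B, star_morphism f /\ forall i, f (z i) = w i.

Definition closed_ideal A (I : set A) : Prop :=
  [/\ closed I, I 0,
      forall x y, I x -> I y -> I (x + y) &
      forall a x, I x -> I (a * x) /\ I (x * a)].

(* A quantum subspace X of the space with algebra A: the algebra C(X),
   together with the quotient map from A onto it. *)
Record quantum_subspace A := QuantumSubspace {
  C_of : cstarType R;
  quot_map : A -> C_of;
  quot_map_morphism : star_morphism quot_map;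
  quot_map_surj : forall y, exists x, quot_map x = y
}.

(* C(X) = A / <S>, where the relations u = v are given by the set S of the
   differences u - v. *)
Definition cut_out_by A (S : set A) (X : quantum_subspace A) : Prop :=
  [set x | quot_map X x = 0] = smallest (@closed_ideal A) S.

End CStarTheory.

Variant ground := RealField | ComplexField.

Variant dotted := DotR | DotC | DotRbar | DotCbar.

Definition underlying (D : dotted) : ground :=
  match D with
  | DotR | DotRbar => RealField
  | DotC | DotCbar => ComplexField
  end.

Definition twisted (D : dotted) : bool :=
  match D with
  | DotR | DotC => false
  | DotRbar | DotCbar => true
  end.

(* The order of the constructors is that of the list in the theorem; in the
   names, t stands for the bar, h for * or **, f for +. *)
Variant ten_spheres := SR | SRh | SRf | StRh | StR | SC | SCh | SCf | StCh | StC.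

(* The free spheres are untwisted here, as in their notation S_{K,{1}}. *)
Definition dotted_of (s : ten_spheres) : dotted :=
  match s with
  | SR | SRh | SRf => DotR
  | StRh | StR => DotRbar
  | SC | SCh | SCf => DotC
  | StCh | StC => DotCbar
  end.

(* 'S_k as permutations of nat fixing all n >= k, so that 'S_k is contained in
   'S_k.+1, and the union S_infty makes sense.  Positions start at 0. *)
Definition perm_nat k (s : 'S_k) (n : nat) : nat :=
  if insub n is Some p then s p : nat else n.

Definition Sfin (k : nat) : set (nat -> nat) := range (@perm_nat k).

Definition Sinf : set (nat -> nat) := \bigcup_k Sfin k.

Definition Sinf_star : set (nat -> nat) :=
  [set f | Sinf f /\ forall n, odd (f n) = odd n].

Definition perms_of (s : ten_spheres) : set (nat -> nat) :=
  match s with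
  | SR | StR | SC | StC => Sinf
  | SRh | StRh | SCh | StCh => Sinf_star
  | SRf | SCf => [set id]
  end.

Section Spheres.
Variables (R : realType) (N : nat).

Definition free_sphere (K : ground) (A : cstarType R) (z : 'I_N -> A) : Prop :=
  match K with
  | RealField =>
      (forall i, star (z i) = z i) /\ \sum_(i < N) z i ^+ 2 = 1
  | ComplexField =>
      \sum_(i < N) z i * star (z i) = 1 /\ \sum_(i < N) star (z i) * z i = 1
  end.

Variables (A : cstarType R) (z : 'I_N -> A).

Definition comm_relations (tw : bool) : set A :=
  [set u | exists i j a b,
     [/\ [set z i; star (z i)] a, [set z j; star (z j)] b &
         u = a * b - (-1) ^+ (tw && (i != j)) * (b * a)]].

Definition half_relations (tw : bool) : set A :=
  [set u | exists i j l a b c,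
     [/\ [set z i; star (z i)] a, [set z j; star (z j)] b,
         [set z l; star (z l)] c &
         u = a * b * c - (-1) ^+ (tw && uniq [:: i; j; l]) * (c * b * a)]].

Definition sphere_relations (s : ten_spheres) : set A :=
  match s with
  | SR | SC => comm_relations false
  | StR | StC => comm_relations true
  | SRh | SCh => half_relations false
  | StRh | StCh => half_relations true
  | SRf | SCf => set0
  end.

Definition variables (K : ground) (i : 'I_N) : set A :=
  match K with
  | RealField => [set z i]
  | ComplexField => [set z i; star (z i)]
  end.

Definition monomial_sign (D : dotted) k (s : 'S_k) (i : 'I_k -> 'I_N) : A :=
  if twisted D then
    (-1) ^+ #|[pred pq : 'I_k * 'I_k |
                [&& pq.1 < pq.2, s pq.2 < s pq.1 & i (s pq.1) != i (s pq.2)]%N]|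
  else 1.

Definition monomial_relations (D : dotted) (F : forall k, set 'S_k) : set A :=
  [set u | exists k (s : 'S_k) (i : 'I_k -> 'I_N) (a : 'I_k -> A),
     [/\ F k s, forall p, variables (underlying D) (i p) (a p) &
         u = \prod_(p < k) a p
             - monomial_sign D s i * \prod_(p < k) a (s p)]].

Implicit Type X : quantum_subspace A.

Definition is_monomial_sphere (D : dotted) X : Prop :=
  exists F : forall k, set 'S_k, cut_out_by (monomial_relations D F) X.

(* X is the sphere over D associated with E; an f in E gives one relation for
   each k such that f is in S_k. *)
Definition is_sphere_of (D : dotted) (E : set (nat -> nat)) X : Prop :=
  cut_out_by (monomial_relations D (fun k => [set s | E (perm_nat s)])) X.

Definition has_presentation_in (D : dotted) X (k : nat) : Prop :=
  exists2 E : set (nat -> nat), E `<=` Sfin k & is_sphere_of D E X.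

(* [None] stands for infinity. *)
Definition depth (D : dotted) X : option nat :=
  match pselect (exists k, `[< has_presentation_in D X k >]) with
  | left e => Some (ex_minn e)
  | right _ => None
  end.

End Spheres.

(* Main.v *)
Require Import Defs.
From mathcomp Require Import all_boot all_order all_algebra.
From mathcomp Require Import all_fingroup.
From mathcomp Require Import all_classical all_reals all_analysis.
From mathcomp Require Import zify.

(** A twisted sign is a coboundary: once each word is multiplied by the parity of
    the number of inversions of its indices, a monomial relation just identifies
    two rearrangements of a word, and the twisted and untwisted cases become the
    same.  The 2-letter relations then give all rearrangements, and the
    relations [abc = cba] give those that preserve the parity of positions.
    Conversely, any element of S_3 other than the identity and the reversal of
    three letters yields commutation, by multiplying with a pair of adjoint
    variables and using [sum_i z_i z_i^* = sum_i z_i^* z_i = 1] to cancel it.  So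
    for E inside S_3 only three ideals arise, for each choice of signs. *)

Set Implicit Arguments.
Unset Strict Implicit.
Unset Printing Implicit Defensive.

Import Order.TTheory GRing.Theory Num.Theory.
Local Open Scope classical_set_scope.
Local Open Scope ring_scope.

(** * Inversions of words and twisted signs *)

Fixpoint inversions (s : seq nat) : nat :=
  if s is x :: t then (count (gtn x) t + inversions t)%N else 0%N.

Definition cross_inversions (u v : seq nat) : nat :=
  (\sum_(x <- u) count (gtn x) v)%N.

Lemma inversions_cat u v :
  inversions (u ++ v) = (inversions u + inversions v + cross_inversions u v)%N.
Proof.
rewrite /cross_inversions; elim: u => [|x u IHu] /=; first by rewrite big_nil addn0.
by rewrite IHu count_cat big_cons; lia.
Qed.

Lemma perm_cross_inversions u u' v v' : perm_eq u u' -> perm_eq v v' ->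
  cross_inversions u v = cross_inversions u' v'.
Proof.
move=> uu' /seq.permP vv'; rewrite /cross_inversions (perm_big _ uu') /=.
by apply: eq_bigr => x _; apply: vv'.
Qed.

Lemma inversions_enum k (f : 'I_k -> nat) :
  inversions [seq f p | p <- enum 'I_k] =
  (\sum_(p < k) \sum_(q < k | p < q) (f q < f p))%N.
Proof.
elim: k f => [|k IHk] f; first by rewrite enum_ord0 big_ord0.
rewrite enum_ordSl /= -map_comp IHk big_ord_recl; congr addn.
  rewrite big_mkcond big_ord_recl /= add0n count_map -sum1_count.
  rewrite big_enum_cond big_mkcond; apply: eq_bigr => q _.
  by rewrite -[_ \in _]/true /=; case: ltnP.
apply: eq_bigr => p _; rewrite [RHS]big_mkcond big_ord_recl /= add0n.
by rewrite -big_mkcond.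
Qed.

(* Modulo 2, the sign of a twisted relation is a coboundary: a pair of positions
   with distinct indices is reversed by [s] exactly when it is an inversion of
   one of the words [i] and [i \o s] and not of the other. *)
Lemma odd_inversions_perm k (s : 'S_k) (i : 'I_k -> nat) :
  odd #|[pred pq : 'I_k * 'I_k |
          [&& pq.1 < pq.2, s pq.2 < s pq.1 & i (s pq.1) != i (s pq.2)]%N]| =
  odd (inversions [seq i p | p <- enum 'I_k] +
       inversions [seq i (s p) | p <- enum 'I_k]).
Proof.
(* After reindexing by [s], the inversions of [i] run over pairs with [s p < s q]. Regrouping them
   by the order of [p] and [q] puts both counts over the same pairs. *)
have split_lt (g : 'I_k -> 'I_k -> nat) :
    (\sum_(p < k) \sum_(q < k | s p < s q) g p q =
     \sum_(p < k) \sum_(q < k | p < q) (if s p < s q then g p q else g q p))%N.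
  transitivity ((\sum_(p < k) \sum_(q < k | p < q) (if s p < s q then g p q else 0)) +
    \sum_(p < k) \sum_(q < k | p < q) (if s q < s p then g q p else 0))%N.
    rewrite [X in (_ + X)%N](exchange_big_dep xpredT) //= -big_split /=.
    apply: eq_bigr => p _; rewrite [LHS]big_mkcond [X in (X + _)%N]big_mkcond.
    rewrite [X in (_ + X)%N]big_mkcond -big_split.
    apply: eq_bigr => q _ /=; case: (ltngtP p q) => [||/val_inj ->] //; last by rewrite ltnn.
    by rewrite addn0.
  rewrite -big_split; apply: eq_bigr => p _; rewrite -big_split.
  apply: eq_bigr => q pq /=; case: ltngtP => // [|/val_inj/perm_inj eq_pq].
    by rewrite addn0.
  by rewrite eq_pq ltnn in pq.
rewrite !inversions_enum (reindex_inj (@perm_inj _ s)) /=.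
under eq_bigr do rewrite (reindex_inj (@perm_inj _ s)) /=.
rewrite split_lt -big_split -sum1_card big_mkcond /=.
rewrite -(pair_bigA _ (fun p q : 'I_k =>
  if [&& p < q, s q < s p & i (s p) != i (s q)]%N then 1 else 0)%N).
(* Parity is additive, so it suffices to compare the contributions of each pair [p < q]. *)
rewrite !(big_morph odd oddD (erefl _)); apply: eq_bigr => p _ /=.
rewrite -big_split [in RHS]big_mkcond !(big_morph odd oddD (erefl _)).
apply: eq_bigr => q _; case: (ltnP p q) => //= pq.
have: nat_of_ord (s p) != s q.
  by apply: contraTneq pq => /val_inj/perm_inj ->; rewrite ltnn.
case: (ltngtP (s p) (s q)) => //= _ _; case: (ltngtP (i (s p)) (i (s q))) => //=.
Qed.

(** * Congruences on words generated by exchanges of letters *)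

Section WordCongruence.
Variables (L : eqType) (r : seq L -> seq L -> Prop).
Hypotheses (r_refl : forall w, r w w)
  (r_trans : forall w1 w2 w3, r w1 w2 -> r w2 w3 -> r w1 w3)
  (r_sym : forall w1 w2, r w1 w2 -> r w2 w1)
  (r_cat : forall u w w' v, r w w' -> r (u ++ w ++ v) (u ++ w' ++ v)).

Lemma word_cons x w w' : r w w' -> r (x :: w) (x :: w').
Proof. by move=> ww'; have := r_cat [:: x] [::] ww'; rewrite !cats0. Qed.

(** Adjacent exchanges bring the head of [w] to the front of [w'], and induction treats the
    tails. *)
Lemma perm_word_congruence : (forall x y, r [:: x; y] [:: y; x]) ->
  forall w w', perm_eq w w' -> r w w'.
Proof.
move=> swap.
have front a w : a \in w -> exists2 t, r w (a :: t) & perm_eq w (a :: t).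
  elim: w => [//|x w IHw]; rewrite inE => /orP[/eqP <-|/IHw[t wat pwat]].
    by exists w.
  exists (x :: t); last first.
    by rewrite (perm_trans (_ : perm_eq _ (x :: a :: t))) ?perm_cons // (perm_catCA [:: x] [:: a]).
  exact: r_trans (word_cons x wat) (r_cat [::] t (swap x a)).
elim=> [|a w IHw] w'; first by move/perm_size/esym/size0nil->.
move=> pw; have [|t w't pw't] := front a w'; first by rewrite -(perm_mem pw) mem_head.
have pwt : perm_eq w t by rewrite -(perm_cons a) (perm_trans pw).
exact: r_trans (word_cons a (IHw _ pwt)) (r_sym w't).
Qed.

(** Rearranging colored words amounts to permuting letters without changing the parity of their
    positions. *)
Fixpoint parity_colored (b : bool) (w : seq L) : seq (L * bool) :=
  if w is x :: t then (x, b) :: parity_colored (~~ b) t else [::].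

Lemma size_parity_colored b w : size (parity_colored b w) = size w.
Proof. by elim: w b => //= x w IHw b; rewrite IHw. Qed.

(** Each exchange moves a letter two places, so a letter with the color of the first position can
    reach the front. Induction treats the tails, with the other starting color. *)
Lemma parity_perm_word_congruence :
  (forall x y z, r [:: x; y; z] [:: z; y; x]) ->
  forall b w w', perm_eq (parity_colored b w) (parity_colored b w') -> r w w'.
Proof.
move=> swap.
have front a b w : (a, b) \in parity_colored b w ->
    exists2 t, r w (a :: t) & perm_eq (parity_colored b w) (parity_colored b (a :: t)).
  (* The recursion drops two letters at once, hence the induction on a bound of the size. *)
  have [n] := ubnP (size w); elim: n w => // n IHn [//|x [|y w]] /=.
    by rewrite inE xpair_eqE eqxx andbT => _ /eqP <-; exists [::].
  rewrite !ltnS !inE !xpair_eqE negbK => wn /or3P[/andP[/eqP <- _]|/andP[_]|].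
  - by exists (y :: w) => //=; rewrite negbK.
  (* The second letter has the color opposite to [b]. *)
  - by case: (b).
  case/IHn=> [|t wat pwat]; first exact: ltnW.
  exists (y :: x :: t) => /=; rewrite ?negbK.
    exact: r_trans (word_cons x (word_cons y wat)) (r_cat [::] t (swap x y a)).
  apply: (perm_trans (_ : perm_eq _ [:: (x, b), (y, ~~ b), (a, b) & parity_colored (~~ b) t])).
    by rewrite !perm_cons.
  by apply/seq.permP => p /=; lia.
move=> b w; elim: w b => [|a w IHw] b w'.
  by move/perm_size/esym; rewrite !size_parity_colored => /size0nil->.
move=> pw; have [|t w't pw't] := front a b w'; first by rewrite -(perm_mem pw) mem_head.
have pwt : perm_eq (parity_colored (~~ b) w) (parity_colored (~~ b) t).
  by rewrite -(perm_cons (a, b)) (perm_trans pw).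
exact: r_trans (word_cons a (IHw _ _ pwt)) (r_sym w't).
Qed.

End WordCongruence.

Lemma parity_colored_enum (L : eqType) k (w : 'I_k -> L) (b : bool) :
  parity_colored b [seq w p | p <- enum 'I_k] =
  [seq (w p, b (+) odd p) | p : 'I_k <- enum 'I_k].
Proof.
elim: k w b => [|k IHk] w b; first by rewrite enum_ord0.
rewrite enum_ordSl /= addbF -[in LHS]map_comp IHk -[in RHS]map_comp; congr cons.
by apply: eq_map => p /=; rewrite addNb addbN.
Qed.

(** * Permutations of the natural numbers with finite support *)

Lemma perm_nat_ord k (s : 'S_k) (p : 'I_k) : perm_nat s p = s p.
Proof. by rewrite /perm_nat valK. Qed.

Lemma perm_nat_lt k (s : 'S_k) n : (perm_nat s n < k)%N = (n < k)%N.
Proof.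
rewrite /perm_nat; case: insubP => [p np _|/negbTE //].
by rewrite np ltn_ord.
Qed.

Lemma perm_nat_out k (s : 'S_k) n : (k <= n)%N -> perm_nat s n = n.
Proof. by rewrite /perm_nat; case: insubP => // p; case: ltnP. Qed.

Lemma perm_nat_inj k (s : 'S_k) : injective (perm_nat s).
Proof.
move=> m n e; have := perm_nat_lt s m; rewrite e perm_nat_lt.
have [nk|kn] := ltnP n k; have [mk|km] := ltnP m k => // _.
  move: e; rewrite -[m]/(val (Ordinal mk)) -[n]/(val (Ordinal nk)) !perm_nat_ord.
  by move=> /val_inj/perm_inj ->.
by move: e; rewrite !perm_nat_out.
Qed.

Lemma Sfin_subset k n : (k <= n)%N -> Sfin k `<=` Sfin n.
Proof.
move=> kn f [s _ <-].
have lt_n (p : 'I_n) : (perm_nat s p < n)%N.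
  have [pk|kp] := ltnP p k; last by rewrite perm_nat_out.
  by apply: leq_trans kn; rewrite perm_nat_lt.
have inj : injective (fun p => Ordinal (lt_n p)) by move=> p q [/perm_nat_inj/val_inj].
exists (perm inj) => //; apply/funext => m.
have [mn|nm] := ltnP m n; last by rewrite !perm_nat_out // (leq_trans kn).
by rewrite -[m]/(val (Ordinal mn)) perm_nat_ord permE.
Qed.

(** One-line notation turns the elements of ['S_3] into six explicit lists, suited to case
    analysis. *)
Definition one_line k (s : 'S_k) : seq nat := [seq (s p : nat) | p <- enum 'I_k].

(** The default [n] of [nth] takes care of the numbers beyond the list, which are fixed. *)
Lemma perm_natE k (s : 'S_k) n : perm_nat s n = nth n (one_line s) n.
Proof.
have [nk|kn] := ltnP n k; last first.
  by rewrite perm_nat_out // nth_default // size_map size_enum_ord.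
have -> : nth n (one_line s) n = s (Ordinal nk).
  rewrite (nth_map (Ordinal nk)) ?size_enum_ord //; congr (nat_of_ord (s _)).
  by apply: val_inj; rewrite /= nth_enum_ord.
by rewrite -perm_nat_ord.
Qed.

Lemma perm_map_enum k (s : 'S_k) : perm_eq [seq s p | p <- enum 'I_k] (enum 'I_k).
Proof.
apply: uniq_perm => [||p].
- by rewrite map_inj_uniq ?enum_uniq //; apply: perm_inj.
- exact: enum_uniq.
by rewrite mem_enum -[p](permKV s) (mem_map (@perm_inj _ s)) mem_enum.
Qed.

Lemma one_line_permutations k (s : 'S_k) : one_line s \in permutations (iota 0 k).
Proof.
rewrite mem_permutations -val_enum_ord /one_line (map_comp val s).
exact/perm_map/perm_map_enum.
Qed.

(** Relations are compared through the closed ideals containing them, which avoids describing the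
    elements of the generated ideal. *)
Lemma smallest_closed_ideal_eq (R : realType) (A : cstarType R) (S T : set A) :
  (forall J : set A, closed_ideal J -> S `<=` J <-> T `<=` J) ->
  smallest (@closed_ideal R A) S = smallest (@closed_ideal R A) T.
Proof.
by move=> ST; apply: eq_bigcapl; split=> J [hJ SJ]; split=> //; apply/(ST J).
Qed.

(** * Signed words modulo a closed ideal *)

Section SignedWords.
Variables (R : realType) (N : nat) (A : cstarType R) (z : 'I_N -> A).
Variable D : dotted.
Hypothesis free_z : free_sphere (underlying D) z.

(* [(i, b)] stands for [z i] if [b] is false, for its adjoint if [b] is true. *)
Let letter := ('I_N * bool)%type.

Definition letter_val (x : letter) : A := if x.2 then star (z x.1) else z x.1.

Definition indices (w : seq letter) : seq nat := [seq nat_of_ord x.1 | x <- w].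

Definition twisted_sign (n : nat) : A := (-1) ^+ (twisted D && odd n).

(* With this normalization a monomial relation identifies the values of two
   rearrangements of a word, without any sign. *)
Definition word_val (w : seq letter) : A :=
  twisted_sign (inversions (indices w)) * \prod_(x <- w) letter_val x.

(** In the real case [z i] is self-adjoint, so both letters of index [i] have the same value and one
    alphabet serves both fields. *)
Lemma variablesP i a :
  variables z (underlying D) i a <-> exists b, a = letter_val (i, b).
Proof.
rewrite /variables /letter_val; case: (underlying D) free_z => [[z_sa _]|_] /=.
  by split=> [->|[[] ->]]; [exists false | apply: z_sa |].
split=> [[->|->]|[[] ->]]; [by exists false|by exists true|by right|by left].
Qed.

Lemma pair_variablesP i a :
  [set z i; star (z i)] a <-> exists b, a = letter_val (i, b).
Proof. by split=> [[->|->]|[[] ->]]; [exists false|exists true|right|left]. Qed.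

Lemma sum_letter_val b : \sum_(i < N) letter_val (i, b) * letter_val (i, ~~ b) = 1.
Proof.
rewrite /letter_val; case: (underlying D) free_z => [[z_sa <-]|[zz' z'z]] /=.
  by apply: eq_bigr => i _; rewrite z_sa !if_same expr2.
by case: b.
Qed.

Lemma twisted_signD m n : twisted_sign (m + n) = twisted_sign m * twisted_sign n.
Proof. by rewrite /twisted_sign oddD; case: twisted; rewrite ?mulr1 ?signr_addb. Qed.

Lemma twisted_signC n (x : A) : x * twisted_sign n = twisted_sign n * x.
Proof. exact: commr_sign. Qed.

Lemma twisted_signK n (x : A) : twisted_sign n * (twisted_sign n * x) = x.
Proof. exact: signrMK. Qed.

Lemma word_val_cat u v : word_val (u ++ v) =
  twisted_sign (cross_inversions (indices u) (indices v)) * (word_val u * word_val v).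
Proof.
rewrite /word_val /indices map_cat inversions_cat big_cat /= !twisted_signD.
rewrite twisted_signC -mulrA; congr (_ * _).
by rewrite -!mulrA; congr (_ * _); rewrite [RHS]mulrA twisted_signC !mulrA.
Qed.

Section Ideal.
Variable J : set A.
Hypothesis ideal_J : closed_ideal J.

Lemma ideal_mull a x : J x -> J (a * x).
Proof. by case: ideal_J => _ _ _ JM /(JM a)[]. Qed.

Lemma ideal_mulr a x : J x -> J (x * a).
Proof. by case: ideal_J => _ _ _ JM /(JM a)[]. Qed.

Lemma ideal_add x y : J x -> J y -> J (x + y).
Proof. by case: ideal_J => _ _ JD _; apply: JD. Qed.

Lemma ideal0 : J 0.
Proof. by case: ideal_J. Qed.

Lemma ideal_opp x : J x -> J (- x).
Proof. by rewrite -mulN1r; apply: ideal_mull. Qed.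

Lemma ideal_sign n x : J (twisted_sign n * x) <-> J x.
Proof.
by split=> [/(ideal_mull (twisted_sign n))|]; [rewrite twisted_signK|apply: ideal_mull].
Qed.

(** Keeping [perm_eq] in the relation is what makes it compatible with concatenation. *)
Definition word_eq (w w' : seq letter) : Prop :=
  perm_eq w w' /\ J (word_val w - word_val w').

Lemma word_eq_refl w : word_eq w w.
Proof. by split; rewrite ?subrr //; apply: ideal0. Qed.

Lemma word_eq_sym w w' : word_eq w w' -> word_eq w' w.
Proof. by move=> [ww' /ideal_opp]; rewrite opprB perm_sym in ww' *; split. Qed.

Lemma word_eq_trans w1 w2 w3 : word_eq w1 w2 -> word_eq w2 w3 -> word_eq w1 w3.
Proof.
move=> [p12 J12] [p23 J23]; split; first exact: perm_trans p23.
by rewrite -(subrK (word_val w2) (word_val w1)) -addrA; apply: ideal_add.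
Qed.

(** The cross inversions with [u] and [v] are unchanged by rearrangement, so both words acquire the
    same sign and the difference is a multiple of an element of [J]. *)
Lemma word_eq_cat u w w' v : word_eq w w' -> word_eq (u ++ w ++ v) (u ++ w' ++ v).
Proof.
move=> [ww' Jww']; split; first by rewrite perm_cat2l perm_cat2r.
rewrite !word_val_cat.
have iww' : perm_eq (indices w) (indices w') by apply: perm_map.
rewrite (perm_cross_inversions iww' (perm_refl _)).
rewrite (perm_cross_inversions (v' := indices (w' ++ v)) (perm_refl (indices u))).
  by rewrite -!(mulrBr, mulrBl); do 3!apply: ideal_mull; apply: ideal_mulr.
by rewrite /indices !map_cat perm_cat2r.
Qed.

Lemma word_eqP w w' : perm_eq w w' ->
  word_eq w w' <->
  J (\prod_(x <- w) letter_val x -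
     twisted_sign (inversions (indices w) + inversions (indices w')) *
       \prod_(x <- w') letter_val x).
Proof.
move=> ww'; rewrite -(ideal_sign (inversions (indices w))) mulrBr twisted_signD.
by rewrite -mulrA twisted_signK; split=> [[]|].
Qed.

Definition adjoint_pair i b : seq letter := [:: (i, b); (i, ~~ b)].

(** The two letters of the pair share their index, so a letter of [u] is inverted with both or with
    neither. *)
Lemma even_cross_pair_r u i b :
  ~~ odd (cross_inversions (indices u) (indices (adjoint_pair i b))).
Proof.
rewrite /cross_inversions; elim: u => [|x u IHu]; rewrite ?big_nil //= big_cons.
by rewrite oddD (negbTE IHu) /=; case: (_ < _)%N.
Qed.

Lemma even_cross_pair_l u i b :
  ~~ odd (cross_inversions (indices (adjoint_pair i b)) (indices u)).
Proof. by rewrite /cross_inversions !big_cons big_nil addn0 addnn odd_double. Qed.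

Lemma word_val_pair i b :
  word_val (adjoint_pair i b) = letter_val (i, b) * letter_val (i, ~~ b).
Proof.
rewrite /word_val /= !big_cons big_nil mulr1 ltnn /=.
by rewrite /twisted_sign andbF mul1r.
Qed.

Lemma word_val_cat_pair w i b :
  word_val (w ++ adjoint_pair i b) = word_val w * (letter_val (i, b) * letter_val (i, ~~ b)).
Proof.
rewrite word_val_cat word_val_pair /twisted_sign.
by rewrite (negbTE (even_cross_pair_r _ _ _)) andbF mul1r.
Qed.

Lemma word_val_pair_cat w i b :
  word_val (adjoint_pair i b ++ w) = letter_val (i, b) * letter_val (i, ~~ b) * word_val w.
Proof.
rewrite word_val_cat word_val_pair /twisted_sign.
by rewrite (negbTE (even_cross_pair_l _ _ _)) andbF mul1r.
Qed.

(** Summed over [i], the pair becomes 1 by [sum_letter_val]. This holds for either order of the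
    adjoints, so [b] and [b'] may differ. *)
Lemma word_eq_cancelr w w' b b' : perm_eq w w' ->
  (forall i, word_eq (w ++ adjoint_pair i b) (w' ++ adjoint_pair i b')) -> word_eq w w'.
Proof.
move=> ww' eq_pair; split=> //.
rewrite -[word_val w]mulr1 -[word_val w']mulr1 -{1}(sum_letter_val b).
rewrite -(sum_letter_val b') !mulr_sumr -sumrB.
apply: (big_ind J ideal0 ideal_add) => i _.
by rewrite -!word_val_cat_pair; have [] := eq_pair i.
Qed.

Lemma word_eq_cancell w w' b b' : perm_eq w w' ->
  (forall i, word_eq (adjoint_pair i b ++ w) (adjoint_pair i b' ++ w')) -> word_eq w w'.
Proof.
move=> ww' eq_pair; split=> //.
rewrite -[word_val w]mul1r -[word_val w']mul1r -{1}(sum_letter_val b).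
rewrite -(sum_letter_val b') !mulr_suml -sumrB.
apply: (big_ind J ideal0 ideal_add) => i _.
by rewrite -!word_val_pair_cat; have [] := eq_pair i.
Qed.

(** * Relations as equalities of words *)

Lemma comm_relations_subP : comm_relations z (twisted D) `<=` J <->
  forall x y, word_eq [:: x; y] [:: y; x].
Proof.
have sub2 x y : word_eq [:: x; y] [:: y; x] <->
    J (letter_val x * letter_val y -
       (-1) ^+ (twisted D && (x.1 != y.1)) * (letter_val y * letter_val x)).
  rewrite (word_eqP (permEl (perm_catC [:: x] [:: y]))) !big_cons !big_nil !mulr1.
  rewrite /twisted_sign /= -val_eqE /=.
  (* When the indices differ, exactly one of the two words has an inversion. *)
  by case: ltngtP.
split=> [sub x y|eq_xy _ [i [j [a [b [/pair_variablesP[c ->] /pair_variablesP[d ->] ->]]]]]].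
  apply/sub2/sub; exists x.1, y.1, (letter_val x), (letter_val y).
  by split=> //; apply/pair_variablesP; [exists x.2|exists y.2]; rewrite -surjective_pairing.
exact/sub2.
Qed.

Lemma half_relations_subP : half_relations z (twisted D) `<=` J <->
  forall x y t, word_eq [:: x; y; t] [:: t; y; x].
Proof.
have sub3 x y t : word_eq [:: x; y; t] [:: t; y; x] <->
    J (letter_val x * letter_val y * letter_val t -
       (-1) ^+ (twisted D && uniq [:: x.1; y.1; t.1]) *
         (letter_val t * letter_val y * letter_val x)).
  have p3 : perm_eq [:: x; y; t] [:: t; y; x] by apply/seq.permP => p /=; lia.
  rewrite (word_eqP p3) !big_cons !big_nil !mulr1 !mulrA.
  rewrite /twisted_sign /= !inE -!val_eqE /=.
  (* Each pair of distinct indices is inverted in exactly one of the word and its reversal. There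
     are three such pairs if all indices differ, otherwise two or none. *)
  by case: (ltngtP x.1 y.1) => // xy; case: (ltngtP x.1 t.1) => // xt;
     case: (ltngtP y.1 t.1) => //; lia.
split=> [sub x y t|eq_xyt _ [i [j [l [a [b [c [/pair_variablesP[a' ->]
    /pair_variablesP[b' ->] /pair_variablesP[c' ->] ->]]]]]]]].
  apply/sub3/sub; exists x.1, y.1, t.1, (letter_val x), (letter_val y), (letter_val t).
  by split=> //; apply/pair_variablesP; [exists x.2|exists y.2|exists t.2];
     rewrite -surjective_pairing.
exact/sub3.
Qed.

Lemma perm_word k (s : 'S_k) (w : 'I_k -> letter) :
  perm_eq [seq w p | p <- enum 'I_k] [seq w (s p) | p <- enum 'I_k].
Proof.
by rewrite (map_comp w s) perm_map // perm_sym perm_map_enum.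
Qed.

(** By [odd_inversions_perm], the sign of the relation is the product of the normalizing signs of
    its two words. *)
Lemma monomial_relations_subP (F : forall k, set 'S_k) :
  monomial_relations z D F `<=` J <->
  forall k (s : 'S_k), F k s -> forall w : 'I_k -> letter,
    word_eq [seq w p | p <- enum 'I_k] [seq w (s p) | p <- enum 'I_k].
Proof.
have prodE k (w : 'I_k -> letter) :
    \prod_(x <- [seq w p | p <- enum 'I_k]) letter_val x = \prod_(p < k) letter_val (w p).
  by rewrite big_map enumT.
have signE k (s : 'S_k) (w : 'I_k -> letter) :
    word_eq [seq w p | p <- enum 'I_k] [seq w (s p) | p <- enum 'I_k] <->
    J (\prod_(p < k) letter_val (w p) -
       monomial_sign A D s (fun p => (w p).1) * \prod_(p < k) letter_val (w (s p))).
  rewrite (word_eqP (perm_word s w)) !prodE.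
  suff -> : monomial_sign A D s (fun p => (w p).1) =
     twisted_sign (inversions (indices [seq w p | p <- enum 'I_k]) +
       inversions (indices [seq w (s p) | p <- enum 'I_k])) by [].
  have idxE (v : 'I_k -> letter) : indices [seq v p | p <- enum 'I_k] =
      [seq ((v p).1 : nat) | p <- enum 'I_k] by rewrite /indices -map_comp.
  rewrite /monomial_sign /twisted_sign !idxE.
  rewrite -(odd_inversions_perm s (fun p => (w p).1 : nat)).
  by case: (twisted D); rewrite ?signr_odd.
split=> [sub k s Fs w|eq_w _ [k [s [i [a [Fs va ->]]]]]].
  apply/signE/sub; exists k, s, (fun p => (w p).1), (fun p => letter_val (w p)).
  by split=> // p; apply/variablesP; exists (w p).2; rewrite -surjective_pairing.
have [b ab] := choice (fun p => (variablesP (i p) (a p)).1 (va p)).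
have := eq_w k s Fs (fun p => (i p, b p)); move/signE.
by under eq_bigr do rewrite -ab; under [in X in _ * X]eq_bigr do rewrite -ab.
Qed.

End Ideal.

(** * Ideals presented by sets of permutations *)

Let perm_relations (E : set (nat -> nat)) :=
  monomial_relations z D (fun k => [set s | E (perm_nat s)]).

Lemma perm_relations3_word_eq J E (s : 'S_3) x y t : closed_ideal J ->
  perm_relations E `<=` J -> E (perm_nat s) ->
  word_eq J [:: x; y; t] [seq nth x [:: x; y; t] n | n <- one_line s].
Proof.
move=> ideal_J /(monomial_relations_subP ideal_J) EJ Es.
have := EJ 3%N s Es (fun p => nth x [:: x; y; t] p).
by rewrite /one_line -map_comp; congr word_eq; rewrite !enum_ordSl enum_ord0.
Qed.

(** Commutation gives all rearrangements, hence all of [E]. Conversely, the four possible values of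
    [s] are two adjacent transpositions and two 3-cycles, and each yields commutation by cancelling
    an adjoint pair. *)
Lemma perm_relations_comm E (s : 'S_3) : E (perm_nat s) ->
  one_line s \notin [:: [:: 0; 1; 2]; [:: 2; 1; 0]]%N ->
  forall J, closed_ideal J ->
    comm_relations z (twisted D) `<=` J <-> perm_relations E `<=` J.
Proof.
move=> Es s_odd J ideal_J.
rewrite (comm_relations_subP ideal_J); split=> [swap|EJ].
  apply/(monomial_relations_subP ideal_J) => k s' _ w.
  apply: perm_word_congruence (perm_word _ _) => //.
  - exact: word_eq_refl.
  - exact: word_eq_trans.
  - exact: word_eq_sym.
  - exact: word_eq_cat.
have rel x y t := perm_relations3_word_eq x y t ideal_J EJ Es.
have s_cases : one_line s \in
    [:: [:: 1; 0; 2]; [:: 0; 2; 1]; [:: 1; 2; 0]; [:: 2; 0; 1]]%N.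
  move: s_odd (one_line_permutations s); rewrite [permutations _]/= !inE.
  by do 6?[case: eqP => //].
have swap2 (x y : letter) : perm_eq [:: x; y] [:: y; x] := permEl (perm_catC [:: x] [:: y]).
have comm_of_cycle : (forall x y t, word_eq J [:: x; y; t] [:: y; t; x]) ->
    forall x y, word_eq J [:: x; y] [:: y; x].
  (* With [c'] the adjoint of [c]: [x y c c' = y (c x c') = y x c' c]; sum over [c]. *)
  move=> cycle x y.
  apply: (word_eq_cancelr ideal_J (swap2 x y) (b := false) (b' := true)) => i.
  have := word_eq_cat ideal_J [::] [:: (i, true)] (cycle x y (i, false)).
  move/(word_eq_trans ideal_J); apply.
  exact (word_eq_cat ideal_J [:: y] [::] (cycle (i, false) x (i, true))).
move: s_cases rel; rewrite !inE => /or4P[]/eqP-> /= rel; last 2 first.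
- exact: comm_of_cycle.
(* This cycle is the inverse of the previous one, so its relation is read backwards. *)
- by apply: comm_of_cycle => x y t; apply: (word_eq_sym ideal_J).
(* An adjacent transposition fixes an end letter, which is completed to an adjoint pair and
   cancelled. *)
- move=> x y; apply: (word_eq_cancelr ideal_J (swap2 x y) (b := false) (b' := false)) => i.
  exact (word_eq_cat ideal_J [::] [:: (i, true)] (rel x y (i, false))).
move=> x y; apply: (word_eq_cancell ideal_J (swap2 x y) (b := false) (b' := false)) => i.
exact (word_eq_cat ideal_J [:: (i, false)] [::] (rel (i, true) x y)).
Qed.

(** The relation of the reversal is [abc = cba], and this in turn gives every rearrangement that
    preserves the parity of positions. *)
Lemma perm_relations_half E (s : 'S_3) : E (perm_nat s) ->
  one_line s = [:: 2; 1; 0]%N -> (forall f, E f -> forall n, odd (f n) = odd n) ->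
  forall J, closed_ideal J ->
    half_relations z (twisted D) `<=` J <-> perm_relations E `<=` J.
Proof.
move=> Es s_rev E_even J ideal_J.
rewrite (half_relations_subP ideal_J); split=> [swap|EJ x y t]; last first.
  by have := perm_relations3_word_eq x y t ideal_J EJ Es; rewrite s_rev.
apply/(monomial_relations_subP ideal_J) => k s' Es' w.
apply: (@parity_perm_word_congruence _ _ _ _ _ _ _ false) => //.
- exact: word_eq_refl.
- exact: word_eq_trans.
- exact: word_eq_sym.
- exact: word_eq_cat.
rewrite !(parity_colored_enum, parity_colored_enum (w \o s')) /=.
(* As [s'] preserves parity, each letter keeps its color, and the second colored word is the first
   one permuted by [s']. *)
have even_s' (p : 'I_k) : odd p = odd (s' p) by rewrite -perm_nat_ord E_even.
rewrite [X in perm_eq _ X](eq_map (g := (fun p : 'I_k => (w p, odd p)) \o s')).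
  by rewrite map_comp perm_map // perm_sym perm_map_enum.
by move=> p; rewrite /= even_s'.
Qed.

Lemma perm_relations_free E : E `<=` [set id] ->
  forall J, closed_ideal J -> set0 `<=` J <-> perm_relations E `<=` J.
Proof.
move=> E_id J ideal_J; split=> _; last exact: sub0set.
apply/(monomial_relations_subP ideal_J) => k s /E_id s_id w.
suff -> : s = 1%g by under [X in word_eq _ _ X]eq_map do rewrite perm1; apply: word_eq_refl.
by apply/permP => p; apply: val_inj; rewrite /= -perm_nat_ord s_id perm1.
Qed.

End SignedWords.

Lemma one_line_tperm02 : one_line (tperm ord0 ord_max : 'S_3) = [:: 2; 1; 0]%N.
Proof. by rewrite /one_line !enum_ordSl enum_ord0 /= !permE. Qed.

Lemma one_line_tperm01 : one_line (tperm ord0 (lift ord0 ord0) : 'S_3) = [:: 1; 0; 2]%N.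
Proof. by rewrite /one_line !enum_ordSl enum_ord0 /= !permE. Qed.

Lemma one_line_012 (s : 'S_3) : one_line s = [:: 0; 1; 2]%N -> perm_nat s = id.
Proof.
by move=> s012; apply/funext => -[|[|[|n]]]; rewrite perm_natE s012 //= nth_nil.
Qed.

Lemma odd_one_line_210 (s : 'S_3) : one_line s = [:: 2; 1; 0]%N ->
  forall n, odd (perm_nat s n) = odd n.
Proof. by move=> s210 [|[|[|n]]]; rewrite perm_natE s210 //= nth_nil. Qed.

(** * The ten spheres and depth at most 3 *)

Section Presentations.
Variables (R : realType) (N : nat) (A : cstarType R) (z : 'I_N -> A).
Implicit Types (X : quantum_subspace A) (E : set (nat -> nat)).

(** The freedom in [E] serves twice: [E = perms_of s] gives the stated presentation, and
    [E = perms_of s]&[Sfin 3] bounds the depth. *)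
Lemma sphere_of_perms (s : ten_spheres) E X :
  free_sphere (underlying (dotted_of s)) z ->
  E `<=` perms_of s -> perms_of s `&` Sfin 3 `<=` E ->
  cut_out_by (sphere_relations z s) X <-> is_sphere_of z (dotted_of s) E X.
Proof.
move=> free_z Es sE; rewrite /is_sphere_of /cut_out_by.
suff -> : smallest (@closed_ideal R A) (sphere_relations z s) =
    smallest (@closed_ideal R A)
      (monomial_relations z (dotted_of s) (fun k => [set p | E (perm_nat p)])) by [].
apply: smallest_closed_ideal_eq => J ideal_J.
have in_Sinf k (p : 'S_k) : Sinf (perm_nat p) by exists k => //; exists p.
have in_Sfin (p : 'S_3) : Sfin 3 (perm_nat p) by exists p.
have comm : perms_of s = Sinf ->
    E (perm_nat (tperm ord0 (lift ord0 ord0) : 'S_3)) /\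
    one_line (tperm ord0 (lift ord0 ord0) : 'S_3) \notin [:: [:: 0; 1; 2]; [:: 2; 1; 0]]%N.
  by move=> s_inf; split; [apply: sE; rewrite s_inf|rewrite one_line_tperm01].
have half : perms_of s = Sinf_star ->
    E (perm_nat (tperm ord0 ord_max : 'S_3)) /\
    (forall f, E f -> forall n, odd (f n) = odd n).
  move=> s_star; split=> [|f /Es]; last by rewrite s_star => -[].
  apply: sE; split=> //; rewrite s_star; split=> //.
  exact: odd_one_line_210 one_line_tperm02.
have commE s_inf := perm_relations_comm free_z (comm s_inf).1 (comm s_inf).2 ideal_J.
have halfE s_star :=
  perm_relations_half free_z (half s_star).1 one_line_tperm02 (half s_star).2 ideal_J.
have freeE s_id := perm_relations_free free_z (E := E) s_id ideal_J.
by case: s free_z Es {sE comm half} commE halfE freeE => /= _ Es commE halfE freeE;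
  first [exact: commE|exact: halfE|exact: freeE].
Qed.

(** Three cases: [E] contains a permutation other than the identity and the reversal; or only these
    two, with the reversal present; or at most the identity. *)
Lemma perms3_sphere (D : dotted) E X : free_sphere (underlying D) z ->
  E `<=` Sfin 3 -> is_sphere_of z D E X ->
  exists s, underlying (dotted_of s) = underlying D /\ cut_out_by (sphere_relations z s) X.
Proof.
move=> free_z E3; rewrite /is_sphere_of /cut_out_by => ->.
suff [s sD eq_s] : exists2 s, underlying (dotted_of s) = underlying D &
    forall J, closed_ideal J -> sphere_relations z s `<=` J <->
      monomial_relations z D (fun k => [set p | E (perm_nat p)]) `<=` J.
  by exists s; split=> //; apply/esym/smallest_closed_ideal_eq.
have [[s [Es s_odd]]|no_odd] := pselect (exists s : 'S_3, E (perm_nat s) /\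
    one_line s \notin [:: [:: 0; 1; 2]; [:: 2; 1; 0]]%N).
  have := perm_relations_comm free_z Es s_odd.
  by case: (D); [exists SR|exists SC|exists StR|exists StC].
have E_cases f : E f -> exists2 s : 'S_3, f = perm_nat s &
    one_line s = [:: 0; 1; 2]%N \/ one_line s = [:: 2; 1; 0]%N.
  move=> Ef; have [s _ sf] := E3 f Ef; exists s => //.
  have : one_line s \in [:: [:: 0; 1; 2]; [:: 2; 1; 0]]%N.
    by apply: contrapT => /negP s_odd; apply: no_odd; exists s; rewrite sf.
  by rewrite !inE => /orP[]/eqP; [left|right].
have [[s [Es s_rev]]|no_rev] := pselect (exists s : 'S_3, E (perm_nat s) /\
    one_line s = [:: 2; 1; 0]%N).
  have E_even f : E f -> forall n, odd (f n) = odd n.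
    by move=> /E_cases[t -> [/one_line_012->|/odd_one_line_210]].
  have := perm_relations_half free_z Es s_rev E_even.
  by case: (D); [exists SRh|exists SCh|exists StRh|exists StCh].
have E_id : E `<=` [set id].
  move=> f Ef; have [s sf [/one_line_012|s_rev]] := E_cases f Ef; first by rewrite sf.
  by case: no_rev; exists s; rewrite -sf.
have := perm_relations_free free_z E_id.
(* Without nontrivial relations the twist is invisible, so the twisted cases also give the untwisted
   free spheres. *)
by case: (D); [exists SRf|exists SCf|exists SRf|exists SCf].
Qed.

(** A minimum is at most [n] exactly when some admissible [k] is; this trades the depth for an
    explicit presentation. *)
Lemma depth_le D X n : (exists2 k, depth z D X = Some k & (k <= n)%N) <->
  exists2 k, (k <= n)%N & has_presentation_in z D X k.
Proof.
rewrite /depth; case: pselect => [e|no_pres]; split.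
- by case=> _ [<-]; case: ex_minnP => k /asboolP pk _ kn; exists k.
- case=> k kn pk; eexists; first by [].
  by case: ex_minnP => m _ /(_ k); rewrite asboolT // => /(_ isT)/leq_trans; apply.
- by case.
by case=> k _ pk; case: no_pres; exists k; apply/asboolP.
Qed.

End Presentations.

Theorem theorem2p5 (R : realType) (N : nat) (K : ground)
    (A : cstarType R) (z : 'I_N -> A)
    (hA : is_universal (free_sphere K) z) (X : quantum_subspace A) :
  (forall s : ten_spheres, underlying (dotted_of s) = K ->
     cut_out_by (sphere_relations z s) X <->
     is_sphere_of z (dotted_of s) (perms_of s) X)
  /\
  ((exists s : ten_spheres,
      underlying (dotted_of s) = K /\ cut_out_by (sphere_relations z s) X) <->
   (exists D : dotted,
      [/\ underlying D = K, is_monomial_sphere z D X &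
          exists2 k : nat, depth z D X = Some k & leq k 3])).
Proof.
have free_z := hA.1; split=> [s sK|].
  by apply: sphere_of_perms => [||f []] //; rewrite sK.
split=> [[s [sK Xs]]|[D [DK _ /depth_le[k k3 [E Ek XE]]]]].
  have XE : is_sphere_of z (dotted_of s) (perms_of s `&` Sfin 3) X.
    by apply/(sphere_of_perms (s := s)) => //; rewrite sK.
  exists (dotted_of s); split=> //; first by eexists; apply: XE.
  by apply/depth_le; exists 3%N => //; exists (perms_of s `&` Sfin 3) => //; apply: subIsetr.
rewrite -DK; apply: (perms3_sphere _ _ XE); first by rewrite DK.
exact: subset_trans Ek (Sfin_subset k3).
Qed.
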